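(* Let $L_2$ be the line in $\mathbb P^3_K$ corresponding to $M_2=\begin{pmatrix}a&0\\0&d\end{pmatrix}$ for some $a,d\in K\setminus\{0,1\}$, and let $\mathcal L=\{L_\infty,L_0,L_1,L_2\}$. Then $G_{\mathcal L}$ is abelian and is isomorphic to the subgroup of $K^*$ generated by $\dfrac ad$ and $\dfrac{a-1}{d-1}$. Moreover, $G_{\mathcal L}$ is finite if and only if $$a=u_1\left(\frac{1-u_2}{u_1-u_2}\right),\qquad d=\frac{1-u_2}{u_1-u_2}$$ for some distinct roots of unity $u_1,u_2\neq 1$. Moreover, for $u_1$ of order $m$ and $u_2$ of order $n$, the group $G_{\mathcal L}$ has order $\mathrm{lcm}(m,n)$; that is, $G_{\mathcal L}$ is the cyclic group of order $\mathrm{lcm}(m,n)$.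
   Context: $K$ is an algebraically closed field and $\mathbb P^3=\mathbb P(K^2\oplus K^2)$. $L_0=\{(v,0)\}$, $L_\infty=\{(0,v)\}$, and the line corresponding to a matrix $M\in\mathrm{GL}_2(K)$ is $\{(v,Mv)\mid v\in K^2\}$; $L_1$ corresponds to $M_1=I$. For three distinct pairwise skew (i.e. disjoint) lines $L_i,L_j,L_k$, the map $f_{ijk}:L_i\to L_j$ sends $p\in L_i$ to the unique intersection point of $L_j$ with the plane spanned by $p$ and $L_k$. For a finite set $\mathcal L$ of at least three pairwise skew lines, $C_{\mathcal L}$ is the groupoid whose objects are the lines of $\mathcal L$ and whose arrows are the maps $f_{ijk}$ (with $L_i,L_j,L_k\in\mathcal L$ distinct) together with all their possible compositions; the groups $\mathrm{Hom}_{C_{\mathcal L}}(L_i,L_i)\subseteq\mathrm{Aut}(L_i)\cong\mathrm{PGL}_2(K)$ are all isomorphic, and $G_{\mathcal L}$ denotes this common group.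
   Formalization: The finiteness criterion is stated only for a ≠ d: if a = d, both generators equal 1, so the group is trivial and finite, while a = u_1 d with u_1 ≠ 1 is impossible. All other clauses are kept for all a, d not in {0,1}. *)

(* Defs.v *)
From HB Require Import structures.
From mathcomp Require Import all_boot all_order all_algebra.
From mathcomp Require Import finmap.
From mathcomp Require Import boolp classical_sets functions cardinality.

Set Implicit Arguments.
Unset Strict Implicit.
Unset Printing Implicit Defensive.

Import GRing.Theory.
Local Open Scope ring_scope.

(* Subgroup generated by a subset, cyclicity, and isomorphism with a subgroup,
   for the possibly infinite groups of [groupType]. *)
Section Groups.
Local Open Scope classical_set_scope.

Definition subgroup_set (G : groupType) (H : set G) : Prop :=
  H 1%g /\ forall x y, H x -> H y -> H (x / y)%g.

Definition subgroup_gen (G : groupType) (S : set G) : set G :=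
  smallest (@subgroup_set G) S.

Definition cyclic_group (G : groupType) : Prop :=
  exists g : G, subgroup_gen [set g] = [set: G].

Definition isog_subgroup (G T : groupType) (H : set T) : Prop :=
  exists phi : {multiplicative G -> T}, injective phi /\ range phi = H.

End Groups.

Section FieldUnits.
Variable K : fieldType.

Record Kunit := KUnit { kval :> K; _ : kval != 0 }.
HB.instance Definition _ := [isSub for kval].
HB.instance Definition _ := [Choice of Kunit by <:].

Lemma kval_neq0 (x : Kunit) : kval x != 0.
Proof. by case: x. Qed.

Definition kone := KUnit (oner_neq0 K).
Definition kmul (x y : Kunit) :=
  KUnit (mulf_neq0 (kval_neq0 x) (kval_neq0 y)).
Lemma kinv_subproof (x : Kunit) : (kval x)^-1 != 0.
Proof. by rewrite invr_eq0 kval_neq0. Qed.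
Definition kinv (x : Kunit) := KUnit (kinv_subproof x).

Lemma kmulA : associative kmul.
Proof. by move=> x y z; apply: val_inj; rewrite /= mulrA. Qed.
Lemma kmul1 : left_id kone kmul.
Proof. by move=> x; apply: val_inj; rewrite /= mul1r. Qed.
Lemma k1mul : right_id kone kmul.
Proof. by move=> x; apply: val_inj; rewrite /= mulr1. Qed.
Lemma kmulV : left_inverse kone kinv kmul.
Proof. by move=> x; apply: val_inj; rewrite /= mulVf ?kval_neq0. Qed.
Lemma kVmul : right_inverse kone kinv kmul.
Proof. by move=> x; apply: val_inj; rewrite /= mulfV ?kval_neq0. Qed.

HB.instance Definition _ := isGroup.Build Kunit kmulA kmul1 k1mul kmulV kVmul.

End FieldUnits.

Section Lines.
Variable K : fieldType.

(* P^3 = P(V) with V = K^2 (+) K^2; its points and lines are the subspaces of V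
   of dimension 1 and 2. *)
Notation V := ('cV[K]_2 * 'cV[K]_2)%type.

Record line := Line { lsub :> {vspace V}; _ : \dim lsub == 2 }.
HB.instance Definition _ := [isSub for lsub].
HB.instance Definition _ := [Choice of line by <:].

Record pt (L : line) :=
  Pt { psub :> {vspace V}; _ : (\dim psub == 1) && (psub <= L)%VS }.
HB.instance Definition _ (L : line) := [isSub for @psub L].
HB.instance Definition _ (L : line) := [Choice of pt L by <:].

Definition skew (L L' : line) : bool := (L :&: L' == 0)%VS.

Lemma dim_line (L : line) : \dim L = 2.
Proof. by case: L => U /= /eqP. Qed.

Lemma dim_pt (L : line) (p : pt L) : \dim p = 1.
Proof. by case: p => U /= /andP[/eqP]. Qed.

Lemma sub_pt (L : line) (p : pt L) : (p <= L)%VS.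
Proof. by case: p => U /= /andP[]. Qed.

Lemma skewC (L L' : line) : skew L L' = skew L' L.
Proof. by rewrite /skew capvC. Qed.

Lemma dimV : \dim {: V} = 4.
Proof. by rewrite dimvf. Qed.

Lemma dim_ptD (Li Lk : line) (p : pt Li) :
  skew Li Lk -> \dim (p + Lk)%VS = 3.
Proof.
move=> /eqP sik; rewrite dimv_disjoint_sum ?dim_pt ?dim_line//.
by apply/eqP; rewrite -subv0 -sik capvS ?sub_pt.
Qed.

Lemma persp_subproof (Li Lj Lk : line) :
  skew Li Lk -> skew Lj Lk -> forall p : pt Li,
  (\dim (Lj :&: (p + Lk)) == 1)%VS && (Lj :&: (p + Lk) <= Lj)%VS.
Proof.
move=> sik /eqP sjk p; rewrite capvSl andbT.
have full : (Lj + (p + Lk))%VS = fullv.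
  apply/eqP; rewrite eqEdim subvf /= dimV.
  rewrite (@leq_trans (\dim (Lj + Lk)%VS)) ?dimvS ?addvS ?addvSr//.
  by rewrite dimv_disjoint_sum ?dim_line.
have := dimv_sum_cap Lj (p + Lk)%VS.
by rewrite full dimV dim_line (dim_ptD p sik) -[(2 + 3)%N]/(4 + 1)%N => /addnI ->.
Qed.

(* The map f_ijk : Li -> Lj, projecting from Lk: the intersection of Lj with
   the plane spanned by p and Lk. *)
Definition persp (Li Lj Lk : line) (sik : skew Li Lk) (sjk : skew Lj Lk)
  (p : pt Li) : pt Lj := Pt (persp_subproof sik sjk p).

Lemma perspK (Li Lj Lk : line) (sik : skew Li Lk) (sjk : skew Lj Lk) :
  cancel (persp sik sjk) (persp sjk sik).
Proof.
move=> p; apply: val_inj => /=; set q := (Lj :&: (p + Lk))%VS.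
have qE : (q + Lk)%VS = (p + Lk)%VS.
  apply/eqP; rewrite eqEdim subv_add capvSr addvSr /=.
  by rewrite (dim_ptD p sik) (dim_ptD (persp sik sjk p) sjk).
apply/esym/eqP; rewrite qE eqEdim subv_cap sub_pt addvSl /= dim_pt.
by have /andP[/eqP-> _] := persp_subproof sik sik p.
Qed.

Record skewset := SkewSet {
  lines :> {fset line};
  _ : (3 <= #|` lines|)%N;
  _ : forall L L', L \in lines -> L' \in lines -> L != L' -> skew L L' }.

Lemma skewsetP (LL : skewset) (i j : LL) : i != j -> skew (val i) (val j).
Proof.
move=> ij; case: LL i j ij => LL /= _ s i j ij.
by apply: s; rewrite ?fsvalP ?(inj_eq val_inj).
Qed.

End Lines.

Section Groupoid.
Variables (K : fieldType) (LL : skewset K).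

(* The groupoid C_LL: its objects are the lines of LL. Identities need not be
   added, as f_jik \o f_ijk = id (perspK) and LL has at least three lines. *)
Inductive arrow : forall i j : LL, (pt (val i) -> pt (val j)) -> Prop :=
| ArrowPersp (i j k : LL) (ij : i != j) (ik : i != k) (jk : j != k) :
    arrow (persp (skewsetP ik) (skewsetP jk))
| ArrowComp (i j k : LL) (f : pt (val i) -> pt (val j))
    (g : pt (val j) -> pt (val k)) :
    arrow f -> arrow g -> arrow (g \o f).

Definition Hom (i j : LL) := {f : pt (val i) -> pt (val j) | arrow f}.

Lemma arrow_id (i : LL) : @arrow i i id.
Proof.
have [j [k [ij ik jk]]] : exists j k : LL, [/\ i != j, i != k & j != k].
  have : (1 < #|[set~ i]|)%N.
    by rewrite cardsC1 -cardfE; case: (LL) => l /=; case: #|` _| => [|[|[]]].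
  case/card_gt1P=> j [k [+ + jk]]; rewrite !finset.inE => ji ki.
  by exists j, k; split; [rewrite eq_sym; exact: ji | rewrite eq_sym; exact: ki |
    exact: jk].
have ji : j != i by rewrite eq_sym.
suff -> : id = persp (skewsetP jk) (skewsetP ik) \o
               persp (skewsetP ik) (skewsetP jk).
  by apply: ArrowComp; apply: ArrowPersp.
by apply/funext => p /=; rewrite perspK.
Qed.

Lemma arrow_inv (i j : LL) (f : pt (val i) -> pt (val j)) : arrow f ->
  exists g, [/\ arrow g, cancel f g & cancel g f].
Proof.
elim=> {i j f} [i j k ij ik jk|i j k f g _ [f' [af ff' f'f]] _ [g' [ag gg' g'g]]].
  exists (persp (skewsetP jk) (skewsetP ik)); split; try exact: perspK.
  have ji : j != i by rewrite eq_sym; exact: ij.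
  exact: (ArrowPersp ji jk ik).
by exists (f' \o g'); split; [exact: ArrowComp | exact: can_comp | exact: can_comp].
Qed.

(* The vertex group Hom(L_i, L_i), with composition as product. *)
Definition vertex_group (i : LL) : Type := Hom i i.

Variable i : LL.
Notation G := (vertex_group i).

HB.instance Definition _ := gen_eqMixin G.
HB.instance Definition _ := gen_choiceMixin G.

Definition vone : G := exist _ _ (arrow_id i).
Definition vmul (f g : G) : G :=
  exist _ (sval f \o sval g) (ArrowComp (svalP g) (svalP f)).
Definition vinv (f : G) : G :=
  let g := cid (arrow_inv (svalP f)) in
  exist _ (sval g) (let: And3 ag _ _ := svalP g in ag).

Lemma v_inj (f g : G) : sval f =1 sval g -> f = g.
Proof.
case: f g => [f af] [g ag] /= /funext fg; rewrite fg in af *.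
by congr exist; exact: Prop_irrelevance.
Qed.

Lemma vmulA : associative vmul.
Proof. by move=> f g h; exact: v_inj. Qed.
Lemma vmul1 : left_id vone vmul.
Proof. by move=> f; exact: v_inj. Qed.
Lemma v1mul : right_id vone vmul.
Proof. by move=> f; exact: v_inj. Qed.
Lemma vmulV : left_inverse vone vinv vmul.
Proof. by move=> f; apply: v_inj => p /=; case: cid => g [] /= _ + _; apply. Qed.
Lemma vVmul : right_inverse vone vinv vmul.
Proof. by move=> f; apply: v_inj => p /=; case: cid => g [] /= _ _; apply. Qed.

HB.instance Definition _ := isGroup.Build G vmulA vmul1 v1mul vmulV vVmul.

End Groupoid.

Section FourLines.
Variable K : fieldType.
Notation V := ('cV[K]_2 * 'cV[K]_2)%type.

Definition infty_emb (v : 'cV[K]_2) : V := (0, v).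
Definition graph_emb (M : 'M[K]_2) (v : 'cV[K]_2) : V := (v, M *m v).

Lemma infty_emb_linear : linear infty_emb.
Proof. by move=> c u v; congr pair; rewrite /= ?scaler0 ?addr0. Qed.
HB.instance Definition _ :=
  GRing.isLinear.Build K 'cV[K]_2 V _ infty_emb infty_emb_linear.

Lemma graph_emb_linear M : linear (graph_emb M).
Proof. by move=> c u v; congr pair; rewrite /= mulmxDr -scalemxAr. Qed.
HB.instance Definition _ M :=
  GRing.isLinear.Build K 'cV[K]_2 V _ (graph_emb M) (graph_emb_linear M).

Lemma dim_limg (f : {linear 'cV[K]_2 -> V}) :
  injective f -> \dim (limg (linfun f)) == 2.
Proof.
move=> f_inj; rewrite limg_dim_eq ?dimvf//.
apply/eqP; rewrite -subv0; apply/subvP => v.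
rewrite memv_cap memv_ker lfunE /= => /andP[_ /eqP fv0].
by rewrite memv0; apply/eqP/f_inj; rewrite fv0 linear0.
Qed.

Lemma infty_emb_inj : injective infty_emb.
Proof. by move=> u v []. Qed.
Lemma graph_emb_inj M : injective (graph_emb M).
Proof. by move=> u v []. Qed.

Definition L_infty : line K := Line (dim_limg infty_emb_inj).
(* The line {(v, M v)}; M = 0 gives L_0 = {(v, 0)}. *)
Definition line_of (M : 'M[K]_2) : line K := Line (dim_limg (@graph_emb_inj M)).

Lemma mem_L_infty (x : V) : (x \in lsub L_infty) = (x.1 == 0).
Proof.
apply/memv_imgP/eqP => [[v _ ->]|]; first by rewrite lfunE.
by case: x => x y /= ->; exists y; rewrite ?memvf// lfunE.
Qed.

Lemma mem_line_of M (x : V) : (x \in lsub (line_of M)) = (x.2 == M *m x.1).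
Proof.
apply/memv_imgP/eqP => [[v _ ->]|]; first by rewrite lfunE.
by case: x => x y /= ->; exists x; rewrite ?memvf// lfunE.
Qed.

Lemma skew_infty M : skew L_infty (line_of M).
Proof.
rewrite /skew -subv0; apply/subvP => -[x y].
rewrite memv_cap mem_L_infty mem_line_of /= => /andP[/eqP-> /eqP->].
by rewrite mulmx0 memv0.
Qed.

Lemma skew_line_of M N : M - N \in unitmx -> skew (line_of M) (line_of N).
Proof.
move=> MN; rewrite /skew -subv0; apply/subvP => -[x y].
rewrite memv_cap !mem_line_of /= => /andP[/eqP-> /eqP MNx].
have x0 : x = 0 by rewrite -(mulKmx MN x) mulmxBl MNx subrr mulmx0.
by rewrite x0 mulmx0 memv0.
Qed.

Lemma skew_neq (L L' : line K) : skew L L' -> L != L'.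
Proof.
apply: contraTneq => <-; rewrite /skew capvv -dimv_eq0 dim_line.
by [].
Qed.

Definition diag2 (a d : K) : 'M[K]_2 := diag_mx (\row_(i < 2) [:: a; d]`_i).

Lemma unit_diag2 a d : a != 0 -> d != 0 -> diag2 a d \in unitmx.
Proof.
move=> a0 d0; rewrite unitmxE det_diag big_ord_recl big_ord1 !mxE /=.
by rewrite unitfE mulf_neq0.
Qed.

Definition L_0 := line_of 0.
Definition L_1 := line_of 1%:M.
Definition L_2 (a d : K) := line_of (diag2 a d).

Lemma in_fset4 (T : choiceType) (t x y z w : T) :
  (t \in [fset x; y; z; w]%fset) = [|| t == x, t == y, t == z | t == w].
Proof. by rewrite !inE -!orbA. Qed.

Section Config.
Variables a d : K.
Hypotheses (a0 : a != 0) (a1 : a != 1) (d0 : d != 0) (d1 : d != 1).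

Let LL : {fset line K} := [fset L_infty; L_0; L_1; L_2 a d]%fset.

Lemma four_skew :
  [/\ skew L_0 L_1, skew L_0 (L_2 a d) & skew L_1 (L_2 a d)].
Proof.
split.
- by apply: skew_line_of; rewrite sub0r -scaleN1r unitmxZ ?unitmx1 ?unitrN1.
- apply: skew_line_of; rewrite sub0r -scaleN1r unitmxZ ?unitrN1//.
  exact: unit_diag2.
- rewrite skewC; apply: skew_line_of.
  have -> : diag2 a d - 1%:M = diag2 (a - 1) (d - 1).
    apply/matrixP => i j; rewrite !mxE.
    case: (i == j); rewrite ?mulr1n ?mulr0n ?subr0//.
    by case: i => [[|[|]]].
  by apply: unit_diag2; rewrite subr_eq0.
Qed.

Lemma four_card : (3 <= #|` LL|)%N.
Proof.
have [s01 s02 s12] := four_skew.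
have -> : LL = (L_infty |` (L_0 |` (L_1 |` [fset L_2 a d])))%fset.
  by rewrite !fsetUA.
have ne (L L' : line K) : skew L L' -> (L == L') = false.
  by move/skew_neq/negbTE.
rewrite !cardfsU1 cardfs1 !in_fset1U !in_fset1 !(ne _ _ (skew_infty _)).
by rewrite (ne _ _ s01) (ne _ _ s02) (ne _ _ s12).
Qed.

Lemma four_pairwise L L' : L \in LL -> L' \in LL -> L != L' -> skew L L'.
Proof.
have [s01 s02 s12] := four_skew.
rewrite !in_fset4 => /or4P[]/eqP-> /or4P[]/eqP->.
- by rewrite eqxx.
- move=> _; exact: skew_infty.
- move=> _; exact: skew_infty.
- move=> _; exact: skew_infty.
- move=> _; rewrite skewC; exact: skew_infty.
- by rewrite eqxx.
- move=> _; exact: s01.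
- move=> _; exact: s02.
- move=> _; rewrite skewC; exact: skew_infty.
- move=> _; rewrite skewC; exact: s01.
- by rewrite eqxx.
- move=> _; exact: s12.
- move=> _; rewrite skewC; exact: skew_infty.
- move=> _; rewrite skewC; exact: s02.
- move=> _; rewrite skewC; exact: s12.
- by rewrite eqxx.
Qed.

Definition four_lines : skewset K := SkewSet four_card four_pairwise.

End Config.
End FourLines.

Definition is_root_of_unity (K : fieldType) (u : K) : Prop :=
  exists2 n, (0 < n)%N & n.-unity_root u.

(* Main.v *)
(* Write each of the four lines as the image of v |-> (s v, t v) with s, t
   diagonal 2x2 matrices. Projection from L_k maps L_i to L_j by the diagonal
   matrix whose r-th entry is the quotient of the determinants
   s_i t_k - t_i s_k and s_j t_k - t_j s_k formed from the r-th entries. Hence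
   every arrow is, in these coordinates, diag(c, 1) up to scalars; the
   multiplier c determines the arrow and is multiplicative under composition.
   For f_ijk it is rho(i,k) / rho(j,k), where rho is symmetric with
   rho(0,2) = a/d, rho(1,2) = (a-1)/(d-1) and value 1 on the other pairs. So
   the multipliers lie in <a/d, (a-1)/(d-1)>, and both generators arise from
   explicit loops. With u1 = a/d and u2 = (a-1)/(d-1), solving for a and d
   gives the parametrization of the finite case. *)
Require Import Defs.
From HB Require Import structures.
From mathcomp Require Import all_boot all_order all_algebra.
From mathcomp Require Import finmap.
From mathcomp Require Import boolp classical_sets functions cardinality.
From mathcomp Require Import separable cyclic cyclotomic ring.

Set Implicit Arguments.
Unset Strict Implicit.
Unset Printing Implicit Defensive.

Import GRing.Theory.
Local Open Scope classical_set_scope.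
Local Open Scope card_scope.
Local Open Scope ring_scope.

(** * Subgroups generated by a set, and finite subgroups of $K^*$ *)

Section Subgroups.
Variable G : groupType.
Implicit Types S H : set G.

Lemma subgroup_gen_subgroup S : subgroup_set (subgroup_gen S).
Proof.
split=> [H [[]]//|x y Sx Sy H HS].
by case: (HS) => -[_ HD] _; apply: HD; [exact: Sx | exact: Sy].
Qed.

Lemma subgroup_setV H x : subgroup_set H -> H x -> H x^-1%g.
Proof. by case=> H1 HD Hx; rewrite -[x^-1%g]mul1g; exact: HD. Qed.

Lemma subgroup_setM H x y : subgroup_set H -> H x -> H y -> H (x * y)%g.
Proof.
move=> sH Hx Hy; rewrite -[y]invgK; apply: sH.2 => //; exact: subgroup_setV.
Qed.

Lemma subgroup_setX H x n : subgroup_set H -> H x -> H (x ^+ n)%g.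
Proof.
move=> sH Hx; elim: n => [|n IH]; first by rewrite expg0; exact: sH.1.
by rewrite expgS; exact: subgroup_setM.
Qed.

End Subgroups.

Lemma multiplicativeX (G T : groupType) (phi : {multiplicative G -> T}) n :
  {morph phi : x / (x ^+ n)%g}.
Proof.
move=> x; elim: n => [|n IH]; last by rewrite !expgS gmulfM IH.
by apply: (mulgI (phi 1%g)); rewrite !expg0 -gmulfM !mulg1.
Qed.

Lemma kvalX (K : fieldType) (z : Kunit K) n : kval (z ^+ n)%g = kval z ^+ n.
Proof. by elim: n => [|n IH]; rewrite ?expg0 ?expr0// expgS exprS -IH. Qed.

Lemma KunitC (K : fieldType) (x y : Kunit K) : (x * y = y * x)%g.
Proof. by apply: val_inj => /=; rewrite mulrC. Qed.

(** Bezout with natural exponents: $\gcd(p,q) + kq = lp$ for some $k, l$, so $z^{\gcd(p,q)}$ is the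
    quotient of $z^{lp}$ by $z^{kq}$. *)
Lemma subgroup_gcd (G : groupType) (H : set G) z p q : subgroup_set H ->
  H (z ^+ p)%g -> H (z ^+ q)%g -> H (z ^+ gcdn p q)%g.
Proof.
move=> sH Hp Hq; have [->|p0] := posnP p; first by rewrite gcd0n.
have [k _ /dvdnP[l e]] := Bezoutl q p0.
rewrite -[(z ^+ _)%g](mulgK (z ^+ (k * q))%g) -expgnDr e.
by apply: sH.2; rewrite mulnC expgnA; exact: subgroup_setX.
Qed.

Lemma unity_subgroup (K : fieldType) N :
  subgroup_set [set z : Kunit K | kval z ^+ N = 1].
Proof.
split; first by rewrite /= expr1n.
by move=> x y /= xN yN; rewrite exprMn exprVn xN yN invr1 mulr1.
Qed.

Lemma finite_unity (K : closedFieldType) N : (0 < N)%N ->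
  finite_set [set z : Kunit K | kval z ^+ N = 1].
Proof.
move=> N0; have [r er] := closed_field_poly_normal ('X^N - 1 : {poly K}).
rewrite (monicP _) ?monicXnsubC // scale1r in er.
apply: (@sub_finite_set _ _ (@kval K @^-1` [set` r])).
  by move=> z /= zN; rewrite -root_prod_XsubC -er; apply/unity_rootP.
by apply: finite_preimage; [move=> x y _ _; exact: val_inj|exact: finite_seq].
Qed.

(** If [z] had infinite order, $n \mapsto z^n$ would embed the natural numbers into the finite set
    [H]. *)
Lemma finite_subgroup_order (K : fieldType) (H : set (Kunit K)) z :
  subgroup_set H -> finite_set H -> H z -> is_root_of_unity (kval z).
Proof.
move=> sH fH Hz; apply: contrapT => nz; apply: infinite_nat.
have fX : finite_set ((fun n => z ^+ n)%g @^-1` H); last first.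
  by apply: sub_finite_set fX => n _; exact: subgroup_setX.
apply: finite_preimage => //.
move=> i j _ _ e; wlog ij : i j e / (i < j)%N => [th|].
    by case: (ltngtP i j) => // ij; [exact: th|apply/esym/th].
  case: nz; exists (j - i)%N; first by rewrite subn_gt0.
  apply/unity_rootP; have zi : kval z ^+ i != 0 by rewrite expf_neq0 ?kval_neq0.
  by apply: (mulfI zi); rewrite -exprD subnKC 1?ltnW// mulr1 -!kvalX e.
Qed.

(** Since $N \neq 0$ in $K$, the polynomial $X^N - 1$ is separable, so it has $N$ distinct roots;
    one of $N$ distinct $N$-th roots of unity is primitive. *)
Lemma closed_prim_root (K : closedFieldType) N : N%:R != 0 :> K ->
  exists w : K, N.-primitive_root w.
Proof.
move=> N0; have [r er] := closed_field_poly_normal ('X^N - 1 : {poly K}).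
have Ngt0 : (0 < N)%N by case: N N0 {er} => //; rewrite eqxx.
rewrite (monicP _) ?monicXnsubC // scale1r in er.
suff /hasP[w] : has N.-primitive_root r by exists w.
apply: has_prim_root => //.
- by apply/allP => z; rewrite -root_prod_XsubC -er.
- by rewrite -separable_prod_XsubC -er separable_Xn_sub_1.
- by rewrite -ltnS -(size_prod_XsubC r id) -er size_XnsubC.
Qed.

(** Listing the subgroup as the powers of one primitive root, with exponents below the lcm, gives
    both its order and its cyclicity. *)
Lemma subgroup_gen2_prim (K : closedFieldType) (x y : Kunit K) m n :
  m.-primitive_root (kval x) -> n.-primitive_root (kval y) ->
  exists2 w : Kunit K, (lcmn m n).-primitive_root (kval w) &
    subgroup_gen [set x; y] = (fun k => w ^+ k)%g @` `I_(lcmn m n).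
Proof.
move=> px py; set N := lcmn m n.
have m0 := prim_order_gt0 px; have n0 := prim_order_gt0 py.
have [w pw] : exists w : K, N.-primitive_root w.
  (* The lcm is nonzero in $K$ because it divides $mn$, and the existence of primitive roots of
     orders $m$ and $n$ makes $m$ and $n$ nonzero in $K$. *)
  apply: closed_prim_root; apply/eqP => N0.
  have := mulf_neq0 (prim_root_natf_neq0 px) (prim_root_natf_neq0 py).
  by rewrite -natrM -muln_lcm_gcd natrM N0 mul0r eqxx.
have w0 : w != 0.
  apply/eqP => w0; have := prim_expr_order pw; rewrite w0 expr0n.
  by rewrite gtn_eqF ?(prim_order_gt0 pw)// => /eqP; rewrite eq_sym oner_eq0.
exists (KUnit w0) => //; set W := KUnit w0.
have sH := subgroup_gen_subgroup [set x; y].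
have Hx : subgroup_gen [set x; y] x by apply: sub_gen_smallest; left.
have Hy : subgroup_gen [set x; y] y by apply: sub_gen_smallest; right.
have xN : kval x ^+ N = 1.
  by apply/eqP; rewrite -(prim_order_dvd px) dvdn_lcml.
have yN : kval y ^+ N = 1.
  by apply/eqP; rewrite -(prim_order_dvd py) dvdn_lcmr.
have [i xi] := prim_rootP pw xN; have [j yj] := prim_rootP pw yN.
have HW : subgroup_gen [set x; y] W.
  (* With $x = w^i$ and $y = w^j$, the exponent $N/g$ kills both [x] and [y]. Their orders then
     divide $N/g$, so $N$ does too, which forces $g = 1$; Bezout expresses [W] through $w^i$, $w^j$
     and $w^N = 1$. *)
  pose g := gcdn (gcdn i j) N.
  have gN : (g %| N)%N := dvdn_gcdr _ _.
  have N0 := prim_order_gt0 pw.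
  have root1 (z : Kunit K) k : (g %| k)%N ->
      kval z = w ^+ k -> kval z ^+ (N %/ g) = 1.
    move=> gk ->; rewrite -exprM muln_divA// -divn_mulAC// mulnC exprM.
    by rewrite (prim_expr_order pw) expr1n.
  have g1 : g = 1%N.
    have : (N %| N %/ g)%N.
      rewrite dvdn_lcm (prim_order_dvd px) (prim_order_dvd py).
      by apply/andP; split; apply/eqP; [apply: root1 xi|apply: root1 yj];
        apply: dvdn_trans (dvdn_gcdl _ _) _;
        [exact: dvdn_gcdl|exact: dvdn_gcdr].
    have g0 : (0 < g)%N := dvdn_gt0 N0 gN.
    move=> /dvdn_leq; rewrite divn_gt0// (dvdn_leq N0 gN) => /(_ isT).
    by case: g g0 {gN root1} => [|[|g]]// _; rewrite leqNgt ltn_Pdiv.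
  have Wx : (W ^+ i)%g = x by apply: val_inj; rewrite [LHS]kvalX; exact/esym.
  have Wy : (W ^+ j)%g = y by apply: val_inj; rewrite [LHS]kvalX; exact/esym.
  have WN : (W ^+ N)%g = 1%g.
    by apply: val_inj; rewrite [LHS]kvalX (prim_expr_order pw).
  have Wij : subgroup_gen [set x; y] (W ^+ gcdn i j)%g.
    by apply: (subgroup_gcd sH); rewrite ?Wx ?Wy.
  have WN1 : subgroup_gen [set x; y] (W ^+ N)%g by rewrite WN; exact: sH.1.
  by have := subgroup_gcd sH Wij WN1; rewrite -/g g1 expg1.
apply/seteqP; split=> [z Hz|_ [k _ <-]]; last exact: (subgroup_setX k sH HW).
have zN : kval z ^+ N = 1.
  by apply: (smallest_sub (@unity_subgroup K N) _ Hz) => _ [->|->].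
have [k zk] := prim_rootP pw zN; exists k; first exact: (ltn_ord k).
by apply: val_inj; rewrite [LHS]kvalX; exact/esym.
Qed.

(** * Points and lines in diagonal coordinates, and the multipliers of arrows *)

Lemma dimv1_line (K : fieldType) (vT : vectType K) (U : {vspace vT}) x :
  \dim U = 1%N -> x \in U -> x != 0 -> U = <[x]>%VS.
Proof.
move=> dU Ux x0; apply/esym/eqP; rewrite eqEdim -memvE Ux dU dim_vline.
by rewrite x0.
Qed.

Lemma cV2P (K : fieldType) (v w : 'cV[K]_2) :
  v 0 0 = w 0 0 -> v 1 0 = w 1 0 -> v = w.
Proof.
move=> e0 e1; apply/matrixP => r c; rewrite ord1.
by case: r => -[|[|//]] lt; [move: e0|move: e1]; congr (_ = _);
  congr fun_of_matrix; exact: val_inj.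
Qed.

Section DiagonalLines.
Variable K : fieldType.
Notation V := ('cV[K]_2 * 'cV[K]_2)%type.

Definition diag_emb (s t : 'rV[K]_2) (v : 'cV[K]_2) : V :=
  (diag_mx s *m v, diag_mx t *m v).

Lemma diag_embZ s t l v : diag_emb s t (l *: v) = l *: diag_emb s t v.
Proof. by rewrite /diag_emb -!scalemxAr. Qed.

Lemma diag_embD s t v w :
  diag_emb s t (v + w) = diag_emb s t v + diag_emb s t w.
Proof. by rewrite /diag_emb !mulmxDr. Qed.

Variable LL : skewset K.
Variables s t : LL -> 'rV[K]_2.
Notation emb i := (diag_emb (s i) (t i)).
Hypothesis mem_lines : forall (i : LL) x,
  x \in lsub (val i) <-> exists v, x = emb i v.
Hypothesis emb_eq0 : forall i v, emb i v = 0 -> v = 0.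

Definition minor (i k : LL) (r : 'I_2) : K :=
  s i 0 r * t k 0 r - t i 0 r * s k 0 r.

(** Elimination of [u]: the first component times the entry of [t k], minus the second times the
    entry of [s k]. *)
Lemma minor_eq i j k v w u m r : emb j w = m *: emb i v + emb k u ->
  minor j k r * w r 0 = m * (minor i k r * v r 0).
Proof.
rewrite /diag_emb !mul_diag_mx => -[/matrixP/(_ r 0) + /matrixP/(_ r 0)].
rewrite !mxE /minor => e1 e2.
rewrite mulrBl [X in X - _]mulrAC [X in _ - X]mulrAC e1 e2; ring.
Qed.

Hypothesis minor_neq0 : forall i k r, i != k -> minor i k r != 0.

(* In the coordinates given by the embeddings, [f] is induced by
   [diag(c, 1)]; the points are compared homogeneously. *)
Definition acts (i j : LL) (f : pt (val i) -> pt (val j)) (c : Kunit K) :=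
  forall (p : pt (val i)) v w,
    emb i v \in psub p -> emb j w \in psub (f p) ->
    w 0 0 * v 1 0 = kval c * v 0 0 * w 1 0.

Lemma pt_gen (i : LL) (p : pt (val i)) :
  exists2 v, v != 0 & psub p = <[emb i v]>%VS.
Proof.
have dp : \dim (psub p) = 1%N := dim_pt p.
have nz : vpick (psub p) != 0 by rewrite vpick0 -dimv_eq0 dp.
have pin := memv_pick (psub p).
have [v ev] := (mem_lines i _).1 (subvP (sub_pt p) _ pin).
exists v; last by rewrite -ev; exact: dimv1_line.
by apply: contraNneq nz => v0; rewrite ev v0 -(scale0r 0) diag_embZ scale0r.
Qed.

Lemma mem_pt (i : LL) (p : pt (val i)) v v' :
  psub p = <[emb i v]>%VS -> (emb i v' \in psub p) -> exists l, v' = l *: v.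
Proof.
move=> -> /vlineP[l e]; exists l; apply/eqP; rewrite -subr_eq0; apply/eqP.
apply: (@emb_eq0 i); rewrite diag_embD e -scaleN1r !diag_embZ scaleN1r.
by rewrite subrr.
Qed.

Lemma emb_neq0 i v : v != 0 -> emb i v != 0.
Proof. by apply: contra_neq => /emb_eq0. Qed.

Lemma pt_of_subproof (i : LL) v : v != 0 ->
  (\dim <[emb i v]>%VS == 1%N) && (<[emb i v]> <= lsub (val i))%VS.
Proof.
move=> v0; rewrite dim_vline emb_neq0//= -memvE.
by apply/mem_lines; exists v.
Qed.

Lemma acts_id i : acts (@id (pt (val i))) 1%g.
Proof.
move=> p v w; have [u _ pu] := pt_gen p.
move=> /(mem_pt pu)[l ->] /(mem_pt pu)[m ->]; rewrite !mxE /=; ring.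
Qed.

Lemma cV2_neq0 (v : 'cV[K]_2) : v 1 0 = 0 -> v != 0 -> v 0 0 != 0.
Proof.
by move=> v1; apply: contra_neq => v0; apply: cV2P; rewrite ?v0 ?v1 mxE.
Qed.

Lemma acts_comp (i j k : LL) (f : pt (val i) -> pt (val j))
    (g : pt (val j) -> pt (val k)) c c' :
  acts f c -> acts g c' -> acts (g \o f) (c' * c)%g.
Proof.
move=> cf cg p v z pv pz /=; have [w w0 fw] := pt_gen (f p).
have wf : emb j w \in psub (f p) by rewrite fw memv_line.
have e1 := cf _ _ _ pv wf; have e2 := cg _ _ _ wf pz.
have [w1|w1] := eqVneq (w 1 0) 0; last first.
  apply: (mulIf w1); transitivity (z 0 0 * w 1 0 * v 1 0); first by ring.
  transitivity (kval c' * z 1 0 * (w 0 0 * v 1 0)); first by rewrite e2; ring.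
  by rewrite e1; ring.
have w00 := cV2_neq0 w1 w0.
move: e1 e2; rewrite w1 !mulr0 => /eqP.
rewrite mulf_eq0 (negPf w00) /= => /eqP->.
move=> /esym/eqP; rewrite !mulf_eq0 (negPf w00) (negPf (kval_neq0 c')) /=.
by move=> /eqP->; rewrite !mulr0.
Qed.

Lemma acts_inj (i j : LL) (f g : pt (val i) -> pt (val j)) c :
  acts f c -> acts g c -> f =1 g.
Proof.
move=> cf cg p; have [v v0 pv] := pt_gen p.
have vp : emb i v \in psub p by rewrite pv memv_line.
have [w w0 fw] := pt_gen (f p); have [z z0 gz] := pt_gen (g p).
have wf : emb j w \in psub (f p) by rewrite fw memv_line.
have zg : emb j z \in psub (g p) by rewrite gz memv_line.
have e1 := cf _ _ _ vp wf; have e2 := cg _ _ _ vp zg.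
(* A vanishing determinant makes [w] and [z] proportional, so both images are the same point. *)
suff e : w 0 0 * z 1 0 = z 0 0 * w 1 0.
  apply: val_inj; rewrite /= gz; apply: dimv1_line => //; first exact: dim_pt.
    rewrite fw; apply/vlineP.
    have [w1|w1] := eqVneq (w 1 0) 0.
      have w00 := cV2_neq0 w1 w0; exists (z 0 0 / w 0 0).
      rewrite -diag_embZ; congr diag_emb; apply: cV2P; rewrite mxE ?divfK//.
      by move: e; rewrite w1 !mulr0 => /eqP;
         rewrite mulf_eq0 (negPf w00) => /eqP.
    exists (z 1 0 / w 1 0).
    rewrite -diag_embZ; congr diag_emb; apply: cV2P; rewrite mxE ?divfK//.
    by rewrite mulrAC [z 1 0 * _]mulrC e mulfK.
  exact: emb_neq0.
have [v1|v1] := eqVneq (v 1 0) 0; last first.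
  apply: (mulIf v1); transitivity ((w 0 0 * v 1 0) * z 1 0); first by ring.
  by rewrite e1 mulrAC -e2; ring.
have v00 := cV2_neq0 v1 v0; move: e1 e2; rewrite v1 !mulr0.
move=> /esym/eqP; rewrite !mulf_eq0 (negPf v00) (negPf (kval_neq0 c)) /=.
move=> /eqP-> /esym/eqP; rewrite !mulf_eq0 (negPf v00) (negPf (kval_neq0 c)) /=.
by move=> /eqP->; rewrite !mulr0.
Qed.

(** The point with coordinates $(1,1)$ detects the multiplier: its image has coordinates $(c\,w_1,
    w_1)$ with $w_1 \neq 0$. *)
Lemma acts_uniq (i j : LL) (f : pt (val i) -> pt (val j)) c c' :
  acts f c -> acts f c' -> c = c'.
Proof.
move=> cf cf'; pose v : 'cV[K]_2 := const_mx 1.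
have v0 : v != 0.
  by apply/eqP => /matrixP /(_ 0 0) /eqP; rewrite !mxE oner_eq0.
pose p := Pt (pt_of_subproof i v0); have [w w0 fw] := pt_gen (f p).
have vp : emb i v \in psub p by rewrite memv_line.
have wf : emb j w \in psub (f p) by rewrite fw memv_line.
have := cf _ _ _ vp wf; have := cf' _ _ _ vp wf; rewrite !mxE !mulr1 => e e'.
apply: val_inj; apply: (@mulIf _ (w 1 0)); last by rewrite /= -e.
by apply: contra_neq w0 => w1; apply: cV2P; rewrite ?e ?w1 ?mulr0 mxE.
Qed.

(** This is $\rho(i,k)$. It is symmetric because both minors change sign when [i] and [k] are
    exchanged. The default 1 is taken at [i = k], where the minors vanish. *)
Definition cross (i k : LL) : Kunit K :=
  insubd (kone K) (minor i k 0 / minor i k 1).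

Lemma kval_cross i k : i != k -> kval (cross i k) = minor i k 0 / minor i k 1.
Proof.
by move=> ik; apply: insubdK; rewrite unfold_in mulf_neq0 ?invr_eq0 ?minor_neq0.
Qed.

Lemma acts_persp (i j k : LL) (ij : i != j) (ik : i != k) (jk : j != k) :
  acts (persp (skewsetP ik) (skewsetP jk)) (cross i k / cross j k)%g.
Proof.
move=> p v w pv; have [v' v'0 pv'] := pt_gen p.
have [l ->] := mem_pt pv' pv.
rewrite /= memv_cap => /andP[_ /memv_addP[x px [z kz e]]].
have [u zu] := (mem_lines k z).1 kz.
move: px; rewrite pv' => /vlineP[m xm].
(* The image lies in the plane spanned by [p] and $L_k$; eliminating the component along $L_k$
   leaves one scalar [m] common to both coordinates, which cancels in the ratio. *)
have eq r : minor j k r * w r 0 = m * (minor i k r * v' r 0).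
  by apply: (minor_eq (u := u)); rewrite -zu -xm.
rewrite /= !kval_cross// !mxE.
have n r := minor_neq0 r jk; have n' r := minor_neq0 r ik.
have E r : w r 0 = m * (minor i k r * v' r 0) / minor j k r.
  by rewrite -eq mulrAC mulfV// mul1r.
by rewrite !E; field; rewrite !n !n'.
Qed.

(** * Bounding the multipliers of arrows by a subgroup, and realizing them by loops *)

Variable H : set (Kunit K).
Hypothesis subH : subgroup_set H.
Hypothesis crossH : forall i k, i != k -> H (cross i k).

Lemma arrow_acts (i j : LL) (f : pt (val i) -> pt (val j)) :
  arrow f -> exists2 c, H c & acts f c.
Proof.
elim=> {i j f} [i j k ij ik jk|i j k f g _ [c Hc cf] _ [c' Hc' cg]].
  exists (cross i k / cross j k)%g; last exact: acts_persp.
  by apply: subH.2; exact: crossH.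
by exists (c' * c)%g; [exact: subgroup_setM|exact: acts_comp].
Qed.

Definition reaches (i j : LL) (c : Kunit K) :=
  exists2 f : pt (val i) -> pt (val j), arrow f & acts f c.

Lemma reaches_id i : reaches i i 1%g.
Proof. by exists id; [exact: arrow_id|exact: acts_id]. Qed.

Lemma reaches_persp i j k : i != j -> i != k -> j != k ->
  reaches i j (cross i k / cross j k)%g.
Proof.
move=> ij ik jk; exists (persp (skewsetP ik) (skewsetP jk)).
  exact: ArrowPersp.
exact: acts_persp.
Qed.

Lemma reaches_comp i j k c c' :
  reaches i j c -> reaches j k c' -> reaches i k (c' * c)%g.
Proof.
case=> f af cf [g ag cg]; exists (g \o f); first exact: ArrowComp af ag.
exact: acts_comp.
Qed.

(** The inverse arrow has some multiplier [c']; composing gives the identity, and uniqueness of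
    multipliers yields $c'c = 1$. *)
Lemma reaches_inv i j c : reaches i j c -> reaches j i c^-1%g.
Proof.
case=> f af cf; have [g [ag fg gf]] := arrow_inv af.
have [c' _ cg] := arrow_acts ag; exists g => //.
suff <- : c' = c^-1%g by [].
have cgf : acts (@id (pt (val i))) (c' * c)%g.
  rewrite (_ : id = g \o f); first exact: acts_comp.
  by apply/funext => x /=; rewrite fg.
by have e := acts_uniq cgf (@acts_id i); rewrite -(mulgK c c') e mul1g.
Qed.

(** Conjugating a loop by an arrow keeps its multiplier, since $K^*$ is commutative. It is therefore
    enough to construct loops at a single line. *)
Lemma reaches_loop i j b c : reaches i j b -> reaches j j c -> reaches i i c.
Proof.
move=> rb rc; have := reaches_comp (reaches_comp rb rc) (reaches_inv rb).
by rewrite (KunitC c b) mulKg.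
Qed.

Lemma reaches_subgroup i : subgroup_set (reaches i i).
Proof.
split; first exact: reaches_id.
by move=> x y rx /reaches_inv ry; exact: reaches_comp ry rx.
Qed.

Variable i : LL.

(** The witness is chosen, but [acts_uniq] makes it independent of the choice; this is why it is
    multiplicative. *)
Definition multiplier (f : vertex_group i) : Kunit K :=
  let: exist2 c _ _ := cid2 (arrow_acts (svalP f)) in c.

Lemma acts_multiplier f : acts (sval f) (multiplier f).
Proof. by rewrite /multiplier; case: cid2. Qed.

Lemma mem_multiplier f : H (multiplier f).
Proof. by rewrite /multiplier; case: cid2. Qed.

Lemma multiplierM : {morph multiplier : f g / (f * g)%g}.
Proof.
move=> f g; apply: (@acts_uniq i i _ _ _ (@acts_multiplier (f * g)%g)).
exact: (acts_comp (@acts_multiplier g) (@acts_multiplier f)).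
Qed.

HB.instance Definition _ := isMultiplicative.Build _ _ multiplier multiplierM.

Lemma multiplier_inj : injective multiplier.
Proof.
move=> f g e; apply: v_inj; apply: (acts_inj (@acts_multiplier f)).
by rewrite e; exact: (@acts_multiplier g).
Qed.

(** The multiplier map is injective with image inside [H]; the hypothesis supplies surjectivity onto
    [H]. *)
Lemma vertex_isog : H `<=` reaches i i -> isog_subgroup (vertex_group i) H.
Proof.
move=> HR; exists multiplier; split; first exact: multiplier_inj.
apply/seteqP; split=> [_ [f _ <-]|c /HR[f af cf]].
  exact: mem_multiplier.
exists (exist _ f af) => //.
exact: (acts_uniq (@acts_multiplier (exist _ f af)) cf).
Qed.

End DiagonalLines.

(** * The group of the configuration $L_\infty, L_0, L_1, L_2$ *)

Section FourLineGroup.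
Variables (K : fieldType) (a d : K).
Hypotheses (a0 : a != 0) (a1 : a != 1) (d0 : d != 0) (d1 : d != 1).
Notation LL := (four_lines a0 a1 d0 d1).

Fact o_infty_subproof : L_infty K \in lines LL.
Proof. by rewrite in_fset4; apply/or4P; apply: Or41; exact: eqxx. Qed.
Fact o_0_subproof : L_0 K \in lines LL.
Proof. by rewrite in_fset4; apply/or4P; apply: Or42; exact: eqxx. Qed.
Fact o_1_subproof : L_1 K \in lines LL.
Proof. by rewrite in_fset4; apply/or4P; apply: Or43; exact: eqxx. Qed.
Fact o_2_subproof : L_2 a d \in lines LL.
Proof. by rewrite in_fset4; apply/or4P; apply: Or44; exact: eqxx. Qed.

Definition o_infty : LL := FSetSub o_infty_subproof.
Definition o_0 : LL := FSetSub o_0_subproof.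
Definition o_1 : LL := FSetSub o_1_subproof.
Definition o_2 : LL := FSetSub o_2_subproof.

(** In each coordinate a line has a slope in $\mathbb P^1(K)$, written as numerator over
    denominator: $\infty$, $0$, $1$, and $a$ or $d$ for $L_2$. *)
Definition slope_den (i : LL) : 'rV[K]_2 :=
  if i == o_infty then 0 else const_mx 1.

Definition slope_num (i : LL) : 'rV[K]_2 :=
  if i == o_infty then const_mx 1 else
  if i == o_0 then 0 else
  if i == o_1 then const_mx 1 else \row_(r < 2) [:: a; d]`_r.

Lemma four_linesP (i : LL) : [\/ i = o_infty, i = o_0, i = o_1 | i = o_2].
Proof.
have := fsvalP i; rewrite in_fset4 => /or4P[]/eqP e;
  [apply: Or41|apply: Or42|apply: Or43|apply: Or44]; exact: val_inj.
Qed.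

Lemma four_lines_neq :
  ((o_0 == o_infty) = false) * ((o_1 == o_infty) = false) *
  ((o_2 == o_infty) = false) * ((o_1 == o_0) = false) *
  ((o_2 == o_0) = false) * ((o_2 == o_1) = false) *
  ((o_infty == o_0) = false) * ((o_infty == o_1) = false) *
  ((o_infty == o_2) = false) * ((o_0 == o_1) = false) *
  ((o_0 == o_2) = false) * ((o_1 == o_2) = false).
Proof.
have [s01 s02 s12] := four_skew a0 a1 d0 d1.
have s_infty M : Defs.skew (L_infty K) (line_of M) := skew_infty M.
have ne (i j : LL) : Defs.skew (val i) (val j) ->
    ((j == i) = false) * ((i == j) = false).
  by move/skew_neq; rewrite (inj_eq val_inj) => /negbTE ij; rewrite eq_sym ij.
have n0 := ne o_infty o_0 (s_infty _); have n1 := ne o_infty o_1 (s_infty _).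
have n2 := ne o_infty o_2 (s_infty _); have n01 := ne o_0 o_1 s01.
have n02 := ne o_0 o_2 s02; have n12 := ne o_1 o_2 s12.
by do ![split]; rewrite ?n0 ?n1 ?n2 ?n01 ?n02 ?n12.
Qed.

Lemma slope_denE : (slope_den o_infty = 0) * (slope_den o_0 = const_mx 1) *
  (slope_den o_1 = const_mx 1) * (slope_den o_2 = const_mx 1).
Proof. by rewrite /slope_den !(eqxx, four_lines_neq). Qed.

Lemma slope_numE : (slope_num o_infty = const_mx 1) * (slope_num o_0 = 0) *
  (slope_num o_1 = const_mx 1) * (slope_num o_2 = \row_(r < 2) [:: a; d]`_r).
Proof. by rewrite /slope_num !(eqxx, four_lines_neq). Qed.

Notation emb i := (diag_emb (slope_den i) (slope_num i)).

Lemma diag_emb_graph (t : 'rV[K]_2) v :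
  diag_emb (const_mx 1) t v = graph_emb (diag_mx t) v.
Proof. by rewrite /diag_emb diag_const_mx mul1mx. Qed.

Lemma mem_line_graph (M : 'M[K]_2) x :
  x \in lsub (line_of M) <-> exists v, x = graph_emb M v.
Proof.
rewrite mem_line_of; split=> [/eqP e|[v ->]//]; exists x.1.
by case: x e => x y /= ->.
Qed.

Lemma four_lines_mem (i : LL) x :
  x \in lsub (val i) <-> exists v, x = emb i v.
Proof.
have [|||] := four_linesP i => ->; rewrite !(slope_denE, slope_numE).
- rewrite mem_L_infty; split=> [/eqP|[v ->]].
    case: x => x y /= ->; exists y.
    by rewrite /diag_emb linear0 mul0mx diag_const_mx mul1mx.
  by rewrite /diag_emb linear0 mul0mx.
- by under eq_exists do rewrite diag_emb_graph linear0; exact: mem_line_graph.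
- under eq_exists do rewrite diag_emb_graph diag_const_mx.
  exact: mem_line_graph.
- by under eq_exists do rewrite diag_emb_graph; exact: mem_line_graph.
Qed.

Lemma four_lines_emb_eq0 i v : emb i v = 0 -> v = 0.
Proof.
have [|||] := four_linesP i => ->;
  rewrite !(slope_denE, slope_numE) /diag_emb ?diag_const_mx ?mul1mx;
  by case.
Qed.

Notation mnr := (@minor K LL slope_den slope_num).

Lemma minorE (i k : LL) (r : 'I_2) :
  mnr i k r = slope_den i 0 r * slope_num k 0 r -
              slope_num i 0 r * slope_den k 0 r.
Proof. by []. Qed.

(** Up to sign, the minors of distinct lines are $1$, an entry of $(a,d)$, or such an entry minus
    $1$. *)
Lemma four_lines_minor_neq0 i k r : i != k -> mnr i k r != 0.
Proof.
have ad0 : [:: a; d]`_r != 0 by case: (r) => -[|[|]].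
have ad1 : [:: a; d]`_r != 1 by case: (r) => -[|[|]].
have [|||] := four_linesP i => ->; have [|||] := four_linesP k => ->;
  rewrite ?eqxx // => _; rewrite minorE !(slope_denE, slope_numE) !mxE;
  rewrite ?(mul0r, mul1r, mulr0, mulr1, subr0, sub0r, oppr_eq0, oner_eq0)//.
- by rewrite subr_eq0.
- by rewrite subr_eq0 eq_sym.
Qed.

Lemma alpha_subproof : a / d != 0.
Proof. by rewrite mulf_neq0 ?invr_eq0. Qed.
Lemma beta_subproof : (a - 1) / (d - 1) != 0.
Proof. by rewrite mulf_neq0 ?invr_eq0 ?subr_eq0. Qed.

Definition alpha : Kunit K := KUnit alpha_subproof.
Definition beta : Kunit K := KUnit beta_subproof.

Notation crs := (@cross K LL slope_den slope_num).

Lemma cross_eq i k (c : Kunit K) :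
  i != k -> mnr i k 0 = kval c * mnr i k 1 -> crs i k = c.
Proof.
move=> ik e; apply: val_inj; rewrite [LHS]kval_cross //;
  last exact: four_lines_minor_neq0.
by rewrite e mulfK// four_lines_minor_neq0.
Qed.

Lemma cross_four :
  (crs o_0 o_2 = alpha) * (crs o_2 o_0 = alpha) *
  (crs o_1 o_2 = beta) * (crs o_2 o_1 = beta) *
  (crs o_0 o_1 = 1%g) * (crs o_1 o_0 = 1%g) *
  (crs o_0 o_infty = 1%g) * (crs o_infty o_0 = 1%g) *
  (crs o_1 o_infty = 1%g) * (crs o_infty o_1 = 1%g) *
  (crs o_2 o_infty = 1%g) * (crs o_infty o_2 = 1%g).
Proof.
have d10 : d - 1 != 0 by rewrite subr_eq0.
do ![split]; apply: cross_eq; rewrite ?four_lines_neq //;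
  rewrite !minorE !(slope_denE, slope_numE) !mxE /=; field; by rewrite ?d0 ?d10.
Qed.

Notation gens := [set alpha; beta].

Lemma gen_alpha : subgroup_gen gens alpha.
Proof. by apply: sub_gen_smallest; left. Qed.

Lemma gen_beta : subgroup_gen gens beta.
Proof. by apply: sub_gen_smallest; right. Qed.

Lemma gen_cross i k : i != k -> subgroup_gen gens (crs i k).
Proof.
have g1 : subgroup_gen gens 1%g := (subgroup_gen_subgroup gens).1.
have [|||] := four_linesP i => ->; have [|||] := four_linesP k => ->;
  rewrite ?cross_four; by [rewrite eqxx|move=> _; exact: g1|
    move=> _; exact: gen_alpha|move=> _; exact: gen_beta].
Qed.

Notation rch := (@reaches K LL slope_den slope_num).

Lemma reaches_persp_four i j k : i != j -> i != k -> j != k ->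
  rch i j (crs i k / crs j k)%g.
Proof.
by move=> *; apply: reaches_persp => //;
  [exact: four_lines_mem|exact: four_lines_emb_eq0|
   exact: four_lines_minor_neq0].
Qed.

Lemma reaches_comp_four i j k c c' :
  rch i j c -> rch j k c' -> rch i k (c' * c)%g.
Proof.
by apply: reaches_comp; exact: four_lines_mem.
Qed.

(** One projection suffices: from $L_1$ when starting at $L_\infty$, and from $L_\infty$ when
    starting at $L_1$ or $L_2$. *)
Lemma reaches_o_0 i : exists b, rch i o_0 b.
Proof.
have [|||] := four_linesP i => ->.
- by eexists; apply: (@reaches_persp_four _ _ o_1); rewrite four_lines_neq.
- exists 1%g.
  exact: (reaches_id four_lines_mem four_lines_emb_eq0).
- by eexists; apply: (@reaches_persp_four _ _ o_infty); rewrite four_lines_neq.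
- by eexists; apply: (@reaches_persp_four _ _ o_infty); rewrite four_lines_neq.
Qed.

Lemma reaches_loop_four i c : rch o_0 o_0 c -> rch i i c.
Proof.
have [b rb] := reaches_o_0 i => rc.
exact: (reaches_loop four_lines_mem four_lines_emb_eq0 four_lines_minor_neq0
  (subgroup_gen_subgroup gens) gen_cross rb rc).
Qed.

Lemma reaches_alpha : rch o_0 o_0 alpha.
Proof.
(* The loop goes $L_0 \to L_\infty$ from $L_2$ and back from $L_1$; only $\rho(0,2)$ differs from
   1. *)
have h1 : rch o_0 o_infty (crs o_0 o_2 / crs o_infty o_2)%g.
  by apply: reaches_persp_four; rewrite four_lines_neq.
have h2 : rch o_infty o_0 (crs o_infty o_1 / crs o_0 o_1)%g.
  by apply: reaches_persp_four; rewrite four_lines_neq.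
by have := reaches_comp_four h1 h2; rewrite !cross_four !divg1 mul1g.
Qed.

Lemma reaches_beta : rch o_0 o_0 beta.
Proof.
(* The loop $L_0 \to L_1 \to L_\infty \to L_0$ projects from $L_\infty$, $L_2$, $L_1$ in turn; only
   $\rho(1,2)$ contributes. *)
have h1 : rch o_0 o_1 (crs o_0 o_infty / crs o_1 o_infty)%g.
  by apply: reaches_persp_four; rewrite four_lines_neq.
have h2 : rch o_1 o_infty (crs o_1 o_2 / crs o_infty o_2)%g.
  by apply: reaches_persp_four; rewrite four_lines_neq.
have h3 : rch o_infty o_0 (crs o_infty o_1 / crs o_0 o_1)%g.
  by apply: reaches_persp_four; rewrite four_lines_neq.
have := reaches_comp_four (reaches_comp_four h1 h2) h3.
by rewrite !cross_four !divg1 mul1g mulg1.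
Qed.

Lemma four_lines_isog (i : LL) :
  isog_subgroup (vertex_group i) (subgroup_gen gens).
Proof.
apply: (vertex_isog four_lines_mem four_lines_emb_eq0 four_lines_minor_neq0
  (subgroup_gen_subgroup gens) gen_cross).
apply: smallest_sub.
  exact: (reaches_subgroup four_lines_mem four_lines_emb_eq0
    four_lines_minor_neq0 (subgroup_gen_subgroup gens) gen_cross).
move=> z gz; apply: reaches_loop_four.
by case: gz => ->; [exact: reaches_alpha|exact: reaches_beta].
Qed.

End FourLineGroup.

(** * Parametrization by the two ratios, and the finite case *)

Lemma ratios_parametrization (K : fieldType) (a d u1 u2 : K) :
  u1 != u2 -> u1 != 1 -> u2 != 1 ->
  a = u1 * ((1 - u2) / (u1 - u2)) -> d = (1 - u2) / (u1 - u2) ->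
  a / d = u1 /\ (a - 1) / (d - 1) = u2.
Proof.
move=> u12 u1n1 u2n1 -> ->.
have n12 : u1 - u2 != 0 by rewrite subr_eq0.
have n1 : 1 - u1 != 0 by rewrite subr_eq0 eq_sym.
have n2 : 1 - u2 != 0 by rewrite subr_eq0 eq_sym.
split; first by field; rewrite n12 n2.
(* Both $a - 1$ and $d - 1$ carry the factor $(1-u_1)/(u_1-u_2)$, nonzero because $u_1 \neq 1$. *)
have -> : u1 * ((1 - u2) / (u1 - u2)) - 1 = u2 * ((1 - u1) / (u1 - u2)).
  by field.
have -> : (1 - u2) / (u1 - u2) - 1 = (1 - u1) / (u1 - u2) by field.
by rewrite mulfK// mulf_neq0 ?invr_eq0.
Qed.

(** The finiteness criterion assumes $a \neq d$: for $a = d$ both generators equal 1 and the group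
    is trivial, whereas the parametrization would force $u_1 = a/d = 1$. *)
Theorem proposition3p5 (K : closedFieldType) (a d : K)
    (a0 : a != 0) (a1 : a != 1) (d0 : d != 0) (d1 : d != 1)
    (L : four_lines a0 a1 d0 d1) :
  let G := vertex_group L in
  [/\ (forall x y : G, (x * y = y * x)%g),
      isog_subgroup G (subgroup_gen
        [set z : Kunit K | kval z = a / d \/ kval z = (a - 1) / (d - 1)]),
      a != d ->
        (finite_set [set: G] <->
         exists u1 u2 : K,
           [/\ is_root_of_unity u1 /\ is_root_of_unity u2,
               [/\ u1 != u2, u1 != 1 & u2 != 1],
               a = u1 * ((1 - u2) / (u1 - u2)) &
               d = (1 - u2) / (u1 - u2)])
    & forall (u1 u2 : K) (m n : nat),
        m.-primitive_root u1 -> n.-primitive_root u2 ->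
        [/\ u1 != u2, u1 != 1 & u2 != 1] ->
        a = u1 * ((1 - u2) / (u1 - u2)) ->
        d = (1 - u2) / (u1 - u2) ->
        ([set: G] #= `I_(lcmn m n)) /\ cyclic_group G].
Proof.
move=> G; pose A := alpha a0 d0; pose B := beta a1 d1.
have -> : [set z : Kunit K | kval z = a / d \/ kval z = (a - 1) / (d - 1)] =
    [set A; B].
  apply/seteqP; split=> z [e|e]; [left|right|left|right].
  - exact: val_inj.
  - exact: val_inj.
  - by rewrite e.
  - by rewrite e.
have isoG : isog_subgroup G (subgroup_gen [set A; B]).
  exact: four_lines_isog.
have [phi [phi_inj phi_ran]] := isoG.
have cardG : [set: G] #= subgroup_gen [set A; B].
  by rewrite card_eq_sym -phi_ran;
    apply: inj_card_eq => x y _ _; exact: phi_inj.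
have sH := subgroup_gen_subgroup [set A; B].
have HA : subgroup_gen [set A; B] A by apply: sub_gen_smallest; left.
have HB : subgroup_gen [set A; B] B by apply: sub_gen_smallest; right.
split=> //.
- by move=> x y; apply: phi_inj; rewrite !gmulfM KunitC.
- move=> ad; rewrite (eq_finite_set cardG); split=> [fH|].
    have d10 : d - 1 != 0 by rewrite subr_eq0.
    have u12 : a / d - (a - 1) / (d - 1) != 0.
      have -> : a / d - (a - 1) / (d - 1) = (d - a) / (d * (d - 1)).
        by field; rewrite d0 d10.
      by rewrite mulf_neq0 ?invr_eq0 ?mulf_neq0// subr_eq0 eq_sym.
    (* Subtracting $a - 1 = u_2(d-1)$ from $a = u_1 d$ gives $(u_1 - u_2)d = 1 - u_2$. *)
    have dE : d = (1 - (a - 1) / (d - 1)) / (a / d - (a - 1) / (d - 1)).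
      by apply: (mulIf u12); rewrite divfK//; field; rewrite d0 d10.
    exists (kval A), (kval B); split.
    + by split; apply: finite_subgroup_order fH _.
    + rewrite -subr_eq0; split=> //=; apply: contra_neq ad => e.
        by rewrite -[LHS](divfK d0) e mul1r.
      by move: (divfK d10 (a - 1)); rewrite e mul1r => /addIr.
    + by rewrite -dE /= divfK.
    + exact: dE.
  move=> [u1 [u2 [[[m m0 u1m] [n n0 u2n]] [u12 u11 u21] ea ed]]].
  have [e1 e2] := ratios_parametrization u12 u11 u21 ea ed.
  (* Both generators lie in the finite group of $mn$-th roots of unity, hence so does the subgroup
     they generate. *)
  have mn0 : (0 < m * n)%N by rewrite muln_gt0 m0.
  apply: sub_finite_set (finite_unity K mn0).
  apply: smallest_sub; first exact: unity_subgroup.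
  move=> _ [->|->] /=; rewrite ?e1 ?e2.
    by move/unity_rootP: u1m => u1m; rewrite exprM u1m expr1n.
  by move/unity_rootP: u2n => u2n; rewrite mulnC exprM u2n expr1n.
- move=> u1 u2 m n pu1 pu2 [u12 u11 u21] ea ed.
  have [e1 e2] := ratios_parametrization u12 u11 u21 ea ed.
  rewrite -e1 in pu1; rewrite -e2 in pu2.
  have [w pw genE] := @subgroup_gen2_prim K A B m n pu1 pu2.
  split.
    apply: (card_eq_trans cardG); rewrite genE; apply: inj_card_eq => i j.
    rewrite !inE /= => iN jN /(congr1 (@kval K)); rewrite !kvalX => /eqP.
    by rewrite (eq_prim_root_expr pw) !modn_small// => /eqP.
  have N0 := prim_order_gt0 pw.
  have [g _ gw] : range phi w.
    (* The exponents run below the lcm, so when the lcm is 1 the exponent 1 is excluded and $w = 1$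
       is written as $w^0$. *)
    rewrite phi_ran genE; have [N1|N1] := eqVneq (lcmn m n) 1%N.
      exists 0%N => //; apply: val_inj; rewrite [LHS]kvalX expr0.
      by have := prim_expr_order pw; rewrite N1 expr1.
    by exists 1%N; rewrite ?expg1//= ltn_neqAle eq_sym N1.
  exists g; apply/seteqP; split=> // x _.
  have : range phi (phi x) by exists x.
  rewrite phi_ran genE => -[k _ wk].
  have -> : x = (g ^+ k)%g.
    apply: phi_inj; rewrite -wk -gw.
    by rewrite multiplicativeX.
  apply: (subgroup_setX _ (subgroup_gen_subgroup _)).
  exact: sub_gen_smallest.
Qed.
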